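(* For $f\in L^p(\mathbb{S}^{d-1})$ if $1\le p<\infty$ and $f\in C(\mathbb{S}^{d-1})$ if $p=\infty$, and for $t>0$, $$\omega_r(f,t)_p\le\widetilde\omega_r(f,t)_p,\qquad 1\le p\le\infty,\quad r\in\mathbb{N}.$$
   Context: $d\ge2$ is an integer, $\mathbb{S}^{d-1}$ is the unit sphere of $\mathbb{R}^d$, $d\sigma$ is the (unnormalized) surface Lebesgue measure on it, and $\|\cdot\|_p$ is the norm of $L^p(\mathbb{S}^{d-1},d\sigma)$ for $1\le p<\infty$ and the sup norm for $p=\infty$. For $Q\in SO(d)$ put $T_Qf(x)=f(Qx)$ and $\triangle_Q^r:=(I-T_Q)^r$. For $1\le i\ne j\le d$ and $\theta\in\mathbb{R}$, $Q_{i,j,\theta}\in SO(d)$ is the rotation by angle $\theta$ in the $(x_i,x_j)$-plane, oriented from $e_i$ to $e_j$: it replaces $(x_i,x_j)$ by $(x_i\cos\theta-x_j\sin\theta,\;x_i\sin\theta+x_j\cos\theta)$ and leaves the other coordinates unchanged; $\triangle_{i,j,\theta}^r:=\triangle^r_{Q_{i,j,\theta}}$. The moduli are $$\omega_r(f,t)_p:=\sup_{|\theta|\le t}\max_{1\le i<j\le d}\|\triangle_{i,j,\theta}^rf\|_p,\qquad \widetilde\omega_r(f,t)_p:=\sup_{Q\in O_t}\|\triangle_Q^rf\|_p,$$ where $O_t:=\{Q\in SO(d):\max_{x\in\mathbb{S}^{d-1}}d(x,Qx)\le t\}$ and $d(x,y)=\arccos\langle x,y\rangle$ is the geodesic distance.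 *)

(* Defs.v *)
From HB Require Import structures.
From mathcomp Require Import all_boot all_order all_algebra.
From mathcomp Require Import all_classical all_reals all_analysis measurable_realfun.

Set Implicit Arguments.
Unset Strict Implicit.
Unset Printing Implicit Defensive.

Import Order.TTheory GRing.Theory Num.Theory.
Import numFieldNormedType.Exports.

Local Open Scope classical_set_scope.
Local Open Scope ring_scope.

(* R^d is 'cV[R]_d.  Its Borel sigma-algebra is the one generated by the
   coordinates, as the library does for tuples. *)
Definition cV_display : measure_display.
Proof. exact: default_measure_display. Qed.

Section measurable_cV.
Context {R : realType} (d : nat).

Let coor (i : 'I_d) (x : 'cV[R]_d) : R := x i 0.

Let cV_set0 : g_sigma_preimage coor set0.
Proof. exact: sigma_algebra0. Qed.

Let cV_setC A : g_sigma_preimage coor A -> g_sigma_preimage coor (~` A).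
Proof. exact: sigma_algebraC. Qed.

Let cV_bigcup (F : (set 'cV[R]_d)^nat) :
  (forall i, g_sigma_preimage coor (F i)) ->
  g_sigma_preimage coor (\bigcup_i (F i)).
Proof. exact: sigma_algebra_bigcup. Qed.

HB.instance Definition _ := @isMeasurable.Build cV_display
  'cV[R]_d (g_sigma_preimage coor) cV_set0 cV_setC cV_bigcup.

Lemma measurable_coor (i : 'I_d) :
  measurable_fun [set: 'cV[R]_d] (fun x : 'cV[R]_d => x i 0).
Proof.
move=> _ Y mY; rewrite setTI; apply: sub_sigma_algebra => /=.
rewrite -bigcup_seq/=; exists i => /=; first by rewrite mem_index_enum.
by exists Y => //; rewrite setTI.
Qed.

Lemma measurable_fun_coorP d1 (T1 : measurableType d1) (f : T1 -> 'cV[R]_d) :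
  (forall i, measurable_fun [set: T1] (fun x => f x i 0)) ->
  measurable_fun [set: T1] f.
Proof.
move=> mf.
pose G := \big[setU/set0]_(i < d) preimage_set_system setT (coor i) measurable.
apply: (@measurability _ _ _ _ setT f G) => // _ [B + <-].
rewrite /G -bigcup_seq => -[i /= _ [A mA <-]].
by rewrite !setTI; rewrite -[X in measurable X]setTI; exact: (mf i).
Qed.

End measurable_cV.

Definition image_measure d1 d2 (T1 : measurableType d1)
    (T2 : measurableType d2) (R : realType)
    (m : {measure set T1 -> \bar R}) (f : T1 -> T2)
    (mf : measurable_fun [set: T1] f) : {measure set T2 -> \bar R} :=
  measure_function_pushforward__canonical__measure_function_Measure m mf.

Section lebesgue_cV.
Context {R : realType}.

Definition cons_cV d (p : 'cV[R]_d * measurableTypeR R) : 'cV[R]_d.+1 :=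
  col_mx (p.2 : R)%:M p.1 : 'cV[R]_(1 + d).

Lemma measurable_cons_cV d : measurable_fun setT (@cons_cV d).
Proof.
apply: measurable_fun_coorP => i; rewrite /cons_cV.
case: (split_ordP (m := 1) (n := d) i) => j ->.
  apply: (eq_measurable_fun snd) => [[v a] _|]; last exact: measurable_snd.
  by apply/esym; rewrite (col_mxEu (m1 := 1)) ord1 mxE mulr1n.
apply: (eq_measurable_fun (fun p : 'cV[R]_d * measurableTypeR R => p.1 j 0)) => [[v a] _|].
  by apply/esym; rewrite (col_mxEd (m1 := 1)).
exact: (measurableT_comp (measurable_coor j) measurable_fst).
Qed.

Fixpoint lebesgue_cV d : {measure set 'cV[R]_d -> \bar R} :=
  match d with
  | 0 => \d_ (0 : 'cV[R]_0)
  | d'.+1 => image_measure (lebesgue_cV d' \x @lebesgue_measure R)%E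
               (@measurable_cons_cV d')
  end.

End lebesgue_cV.

Section sphere.
Context {R : realType} {d : nat}.
Implicit Types (x y : 'cV[R]_d) (Q : 'M[R]_d) (f : 'cV[R]_d -> R).

Definition dotp x y : R := \sum_(i < d) x i 0 * y i 0.

Definition enorm x : R := Num.sqrt (dotp x x).

Definition sphere : set 'cV[R]_d := [set x | enorm x = 1].

Definition punctured_ball : set 'cV[R]_d := [set x | 0 < enorm x <= 1].

Definition normalize x : 'cV[R]_d := (enorm x)^-1 *: x.

Lemma measurable_enorm : measurable_fun [set: 'cV[R]_d] enorm.
Proof.
rewrite (_ : enorm = (@powR R ^~ 2^-1) \o (fun x => dotp x x)); last first.
  apply/funext => x /=; rewrite powR12_sqrt//.
  by apply: sumr_ge0 => i _; rewrite -expr2 sqr_ge0.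
apply: (measurableT_comp (measurable_powR _)).
by apply: measurable_sum => i; apply: measurable_funM; exact: measurable_coor.
Qed.

Lemma measurable_punctured_ball : measurable punctured_ball.
Proof.
rewrite (_ : punctured_ball = enorm @^-1` `]0, 1]%classic); last first.
  by apply/seteqP; split=> x /=; rewrite in_itv.
by rewrite -[X in measurable X]setTI; exact: measurable_enorm.
Qed.

Lemma measurable_normalize : measurable_fun [set: 'cV[R]_d] normalize.
Proof.
apply: measurable_fun_coorP => i.
apply: (eq_measurable_fun (fun x => (enorm x) `^ (-1) * x i 0)) => [x _|].
  by rewrite mxE powR_inv1// sqrtr_ge0.
apply: measurable_funM; last exact: measurable_coor.
exact: (measurableT_comp (measurable_powR _) measurable_enorm).
Qed.

(* sigma(A) = d * |{x : 0 < |x| <= 1, x / |x| \in A}|, the unnormalized surface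
   measure in polar coordinates, as a measure on R^d carried by the sphere. *)
Definition surface_measure : {measure set 'cV[R]_d -> \bar R} :=
  mscale (d%:R%:nng : {nonneg R})
    (image_measure (mrestr (lebesgue_cV d) measurable_punctured_ball)
       measurable_normalize).

(* A function on the sphere is given by a function on R^d, of which only the
   restriction to the sphere matters; f \_ sphere vanishes off the sphere. *)
Definition sphere_space (p : \bar R) f : Prop :=
  if p == +oo%E then {within sphere, continuous f}
  else (f \_ sphere) \in Lfun surface_measure p.

Definition sphere_norm (p : \bar R) f : \bar R :=
  if p == +oo%E then ereal_sup [set `|f x|%:E | x in sphere]
  else ('N[surface_measure]_p [EFin \o (f \_ sphere)])%E.

Definition SO : set 'M[R]_d := [set Q | Q *m Q^T = 1%:M /\ \det Q = 1].

Definition translation Q f : 'cV[R]_d -> R := fun x => f (Q *m x).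

Definition difference (r : nat) Q f : 'cV[R]_d -> R :=
  iter r (fun g => g \- translation Q g) f.

Definition rotation (i j : 'I_d) (theta : R) : 'M[R]_d :=
  \matrix_(k, l)
    if k == i then cos theta *+ (l == i) - sin theta *+ (l == j)
    else if k == j then sin theta *+ (l == i) + cos theta *+ (l == j)
    else (k == l)%:R.

Definition modulus (r : nat) f (t : R) (p : \bar R) : \bar R :=
  ereal_sup [set \big[maxe/-oo%E]_(i < d) \big[maxe/-oo%E]_(j < d | (i < j)%N)
                    sphere_norm p (difference r (rotation i j theta) f)
            | theta in [set theta : R | `|theta| <= t]].

Definition geodesic x y : R := acos (dotp x y).

Definition O_ (t : R) : set 'M[R]_d :=
  [set Q | SO Q /\
    (ereal_sup [set (geodesic x (Q *m x))%:E | x in sphere] <= t%:E)%E].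

Definition modulus_tilde (r : nat) f (t : R) (p : \bar R) : \bar R :=
  ereal_sup [set sphere_norm p (difference r Q f) | Q in O_ t].

End sphere.

(* Main.v *)
Require Import Defs.
From mathcomp Require Import all_boot all_order all_algebra.
From mathcomp Require Import all_classical all_reals all_analysis.
From mathcomp Require Import ring lra.

Import Order.TTheory GRing.Theory Num.Theory.

(** A rotation by an angle theta in a coordinate plane moves no point of the
    sphere by more than |theta|: it fixes the component of x orthogonal to the
    plane and turns the component u in the plane by theta, so that
    <x, Qx> = cos theta |u|^2 + (1 - |u|^2), which is at least cos theta
    ([cos_le_dotp_rotation]).  As arccos is decreasing, d(x, Qx) is at most
    arccos (cos theta), hence at most |theta| ([geodesic_rotation]).

    Such a rotation also has determinant 1 ([det_rotation]), so every rotation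
    with |theta| <= t lies in O_t ([rotation_in_O]).  The supremum defining
    the first modulus thus runs over a subset of the transformations that
    define the second, whatever the norm, the order r and the function f. *)

Local Open Scope ring_scope.

(** Rows are the convenient view of a rotation: the product with any number of
    columns serves both for products of rotations and for the action on
    vectors. *)
Lemma rotation_mulmxE (R : realType) (d n : nat) (i j : 'I_d) (a : R)
    (A : 'M[R]_(d, n)) (k : 'I_d) (l : 'I_n) :
  (rotation i j a *m A) k l =
    if k == i then cos a * A i l - sin a * A j l
    else if k == j then sin a * A i l + cos a * A j l
    else A k l.
Proof.
have pick1 c m : \sum_s (c *+ (s == m)) * A s l = c * A m l.
  rewrite (bigD1 m)//= eqxx mulr1n big1 ?addr0// => s /negbTE ->.
  by rewrite mulr0n mul0r.
rewrite mxE; under eq_bigr do rewrite mxE.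
case: ifP => _.
  under eq_bigr do rewrite mulrBl.
  by rewrite sumrB !pick1.
case: ifP => _.
  under eq_bigr do rewrite mulrDl.
  by rewrite big_split !pick1.
under eq_bigr do rewrite eq_sym.
by rewrite pick1 mul1r.
Qed.

Lemma rotationD (R : realType) (d : nat) (i j : 'I_d) (a b : R) :
  i != j -> rotation i j a *m rotation i j b = rotation i j (a + b).
Proof.
rewrite eq_sym => /negbTE ji; apply/matrixP => k l.
rewrite rotation_mulmxE !mxE !eqxx ji cosD sinD.
have [_|_] := eqVneq k i; last have [_|_ //] := eqVneq k j;
  by case: (l == i); case: (l == j); rewrite ?mulr1n ?mulr0n; ring.
Qed.

Lemma rotation0 (R : realType) (d : nat) (i j : 'I_d) :
  rotation i j (0 : R) = 1%:M.
Proof.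
apply/matrixP => k l; rewrite !mxE cos0 sin0 !mul0rn subr0 add0r.
by case: eqP => [->|_]; [rewrite eq_sym|case: eqP => [->|//]; rewrite eq_sym].
Qed.

Lemma tr_rotation (R : realType) (d : nat) (i j : 'I_d) (a : R) :
  i != j -> (rotation i j a)^T = rotation i j (- a).
Proof.
move=> ij; have excl m : ~~ ((m == i) && (m == j)).
  by apply/negP => /andP[/eqP-> /eqP ijE]; rewrite ijE eqxx in ij.
apply/matrixP => k l; rewrite !mxE cosN sinN; have [->|_] := eqVneq k l.
  by case: (l == i) (l == j) (excl l) => -[]// _; ring.
by case: (k == i) (k == j) (excl k) => -[]// _;
  case: (l == i) (l == j) (excl l) => -[]// _; rewrite ?mulr1n ?mulr0n; ring.
Qed.

Lemma rotation_orthogonal (R : realType) (d : nat) (i j : 'I_d) (a : R) :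
  i != j -> rotation i j a *m (rotation i j a)^T = 1%:M.
Proof. by move=> ij; rewrite tr_rotation// rotationD// subrr rotation0. Qed.

(** The rotation by [a] is the square of the rotation by [a / 2], so its
    determinant is the square of that of an orthogonal matrix. *)
Lemma det_rotation (R : realType) (d : nat) (i j : 'I_d) (a : R) :
  i != j -> \det (rotation i j a) = 1.
Proof.
move=> ij; rewrite [a]splitr -rotationD// det_mulmx.
by rewrite -[X in _ * X]det_tr -det_mulmx rotation_orthogonal// det1.
Qed.

(** Only the component of [x] in the plane of rotation contributes to the
    defect [|x|^2 - <x, Qx>]. *)
Lemma dotp_rotation (R : realType) (d : nat) (i j : 'I_d) (a : R)
    (x : 'cV[R]_d) : i != j ->
  dotp x (rotation i j a *m x) =
    dotp x x - (1 - cos a) * (x i 0 ^+ 2 + x j 0 ^+ 2).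
Proof.
move=> ij; have ji : j != i by rewrite eq_sym.
rewrite /dotp (bigD1 i)//= (bigD1 j)//= [in RHS](bigD1 i)//= [in RHS](bigD1 j)//=.
rewrite !rotation_mulmxE eqxx (negbTE ji) eqxx.
under eq_bigr => k /andP[/negbTE ki /negbTE kj].
  rewrite rotation_mulmxE ki kj; over.
by ring.
Qed.

Lemma plane_le_dotp (R : realType) (d : nat) (i j : 'I_d) (x : 'cV[R]_d) :
  i != j -> x i 0 ^+ 2 + x j 0 ^+ 2 <= dotp x x.
Proof.
move=> ij; rewrite /dotp (bigD1 i)//= (bigD1 j) 1?eq_sym//= -!expr2 addrA.
by rewrite lerDl sumr_ge0// => k _; rewrite -expr2 sqr_ge0.
Qed.

Lemma dotp_sphere (R : realType) (d : nat) (x : 'cV[R]_d) :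
  sphere x -> dotp x x = 1.
Proof.
rewrite /sphere/= /enorm => /(congr1 (fun s => s ^+ 2)).
by rewrite sqr_sqrtr ?expr1n// sumr_ge0// => k _; rewrite -expr2 sqr_ge0.
Qed.

(** The lower bound is attained on the plane of rotation; the upper one keeps
    the product in the domain of arccos. *)
Lemma cos_le_dotp_rotation (R : realType) (d : nat) (i j : 'I_d) (a : R)
    (x : 'cV[R]_d) : i != j -> sphere x ->
  cos a <= dotp x (rotation i j a *m x) <= 1.
Proof.
move=> ij /dotp_sphere x1; rewrite dotp_rotation// x1.
have := plane_le_dotp _ _ _ _ x ij; rewrite x1 => s1.
have s0 : 0 <= x i 0 ^+ 2 + x j 0 ^+ 2 by rewrite addr_ge0 ?sqr_ge0.
by have c1 := cos_le1 a; apply/andP; split; nra.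
Qed.

Lemma acos_le (R : realType) (a y : R) :
  cos a <= y <= 1 -> acos y <= `|a|.
Proof.
move=> /andP[ay y1]; have yB : -1 <= y <= 1 by rewrite y1 (le_trans (cos_geN1 a)).
have /andP[acos0 acospi] : 0 <= acos y <= pi by rewrite acos_ge0// acos_lepi.
(* beyond pi the bound is vacuous, as arccos takes its values in [0, pi] *)
have [api|/ltW pia] := leP `|a| pi; last exact: le_trans acospi pia.
rewrite leNgt; apply/negP; rewrite -ltr_cos ?in_itv/= ?normr_ge0 ?acos0//.
by rewrite cos_norm acosK ?in_itv//= ltNge ay.
Qed.

Lemma geodesic_rotation (R : realType) (d : nat) (i j : 'I_d) (a : R)
    (x : 'cV[R]_d) : i != j -> sphere x ->
  geodesic x (rotation i j a *m x) <= `|a|.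
Proof. by move=> ij sx; apply: acos_le; exact: cos_le_dotp_rotation. Qed.

Lemma rotation_in_O (R : realType) (d : nat) (i j : 'I_d) (a t : R) :
  i != j -> `|a| <= t -> O_ t (rotation i j a).
Proof.
move=> ij a_le_t; split.
  by split; [exact: rotation_orthogonal|exact: det_rotation].
apply: ge_ereal_sup => _ [x sx <-]; rewrite lee_fin.
exact: le_trans (geodesic_rotation _ _ _ _ a _ ij sx) a_le_t.
Qed.

Theorem proposition2p3 (R : realType) (d : nat) (hd : (2 <= d)%N)
  (p : \bar R) (hp : (1 <= p)%E)
  (f : 'cV[R]_d -> R) (hf : sphere_space p f)
  (r : nat) (t : R) (ht : 0 < t) :
  (modulus r f t p <= modulus_tilde r f t p)%E.
Proof.
apply: ge_ereal_sup => _ [a a_le_t <-].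
apply: bigmax_le => [|i _]; first exact: leNye.
apply: bigmax_le => [|j ij]; first exact: leNye.
apply: ereal_sup_ubound; exists (rotation i j a) => //.
by apply: rotation_in_O => //; rewrite -val_eqE ltn_eqF.
Qed.
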